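(* Let the $mk$ entry positions of matrices in $\mathbb{R}^{m\times k}$ be partitioned into $d_{\mathrm{grp}}\ge3$ disjoint nonempty groups, and let $p=1+\frac1{\ln(d_{\mathrm{grp}})}$, $q=\frac p{p-1}$. Consider the closed-loop system, for $t\in\mathbb{Z}_+$, $$X_{t+1}=\mathcal{A}(X_t)+\mathcal{B}\bigl(\Theta\Psi(X_t,t)+U_t\bigr),\qquad U_t=-\mathcal{K}(X_t)-\widehat{\Theta}_t\Psi(X_t,t)+U_t^{\mathrm d},$$ with arbitrary initial state $X_0\in\mathbb{R}^{n_1\times n_2}$, where $\widehat\Theta_0=0$ and $$\widehat{\Theta}_{t+1}=\nabla f^*_{p,2}\bigl(\nabla f_{p,2}(\widehat{\Theta}_t)-\eta_{t+1}\nabla J_t(\widehat{\Theta}_t)\bigr),\qquad \eta_{t+1}=\frac{2J_t(\widehat{\Theta}_t)}{\epsilon_{t+1}+\|\nabla J_t(\widehat{\Theta}_t)\|_{\infty,2}^2},$$ for a nonnegative bounded sequence $\{\epsilon_{t+1}\}_{t\in\mathbb{Z}_+}$. Suppose that $\Theta\in\mathbb{R}^{m\times k}$ is $s$-group sparse, i.e. at most $s$ of its groups $\Theta_1,\dots,\Theta_{d_{\mathrm{grp}}}$ are nonzero, where $s$ is a positive integer. Then for every integer $T\ge1$ the regret $\operatorname{Reg}(T):=\sum_{t=0}^{T-1}J_t(\widehat\Theta_t)$ satisfies $$\operatorname{Reg}(T)\le\frac e2\,s^{\frac{\ln(d_{\mathrm{grp}})}{1+\ln(d_{\mathrm{grp}})}}\,\|\Theta\|_{\infty,2}\sqrt{\ln(d_{\mathrm{grp}})\sum_{t=0}^{T-1}\left(\epsilon_{t+1}+\|\nabla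 J_t(\widehat\Theta_t)\|_{\infty,2}^2\right)} .$$
   Context: Fix positive integers $n_1,n_2,m,k$. Matrix spaces carry the Frobenius inner product $\langle X,Y\rangle=\operatorname{Tr}(X^\top Y)$ and Frobenius norm $\|\cdot\|_{\mathrm F}$. $\mathcal{A}:\mathbb{R}^{n_1\times n_2}\to\mathbb{R}^{n_1\times n_2}$, $\mathcal{B}:\mathbb{R}^{m\times n_2}\to\mathbb{R}^{n_1\times n_2}$ and $\mathcal{K}:\mathbb{R}^{n_1\times n_2}\to\mathbb{R}^{m\times n_2}$ are linear operators such that $\mathcal{A}-\mathcal{B}\mathcal{K}$ (i.e. $X\mapsto\mathcal{A}(X)-\mathcal{B}(\mathcal{K}(X))$) is Schur stable (spectral radius $<1$). $\mathcal{B}^\top$ is the adjoint of $\mathcal{B}$: $\langle\mathcal{B}(U),V\rangle=\langle U,\mathcal{B}^\top(V)\rangle$. $\Psi:\mathbb{R}^{n_1\times n_2}\times\mathbb{Z}_+\to\mathbb{R}^{k\times n_2}$ is a map (the regressor), $\{U_t^{\mathrm d}\}_{t\in\mathbb{Z}_+}\subset\mathbb{R}^{m\times n_2}$ is a bounded sequence, and $\Theta\in\mathbb{R}^{m\times k}$ is the fixed true parameter. Residual, loss and gradient: $$\widetilde X_{t+1}:=X_{t+1}-(\mathcal{A}-\mathcal{B}\mathcal{K})(X_t)-\mathcal{B}(U_t^{\mathrm d})=\mathcal{B}\bigl((\Theta-\widehat\Theta_t)\Psi(X_t,t)\bigr),$$ $$J_t(\widehat\Theta_t):=\tfrac12\bigl\|\mathcal{B}\bigl((\Theta-\widehat\Theta_t)\Psi(X_t,t)\bigr)\bigr\|_{\mathrm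 F}^2=\tfrac12\|\widetilde X_{t+1}\|_{\mathrm F}^2,\qquad \nabla J_t(\widehat\Theta_t)=-\mathcal{B}^\top(\widetilde X_{t+1})\Psi(X_t,t)^\top .$$ For $Q\in\mathbb{R}^{m\times k}$, $Q_i$ denotes the collection of entries of $Q$ in the $i$-th group and $\|Q_i\|_2$ its Euclidean norm. For $1\le r<\infty$, $\|Q\|_{r,2}=\bigl(\sum_{i=1}^{d_{\mathrm{grp}}}\|Q_i\|_2^r\bigr)^{1/r}$, and $\|Q\|_{\infty,2}=\max_i\|Q_i\|_2$. The mirror map is $f_{p,2}(Q)=\frac{d_{\mathrm{grp}}^{2-2/p}}{2(p-1)}\|Q\|_{p,2}^2$, with Fenchel conjugate $f_{p,2}^*$; explicitly, for $i=1,\dots,d_{\mathrm{grp}}$, $$\bigl(\nabla f_{p,2}(Q)\bigr)_i=\frac{d_{\mathrm{grp}}^{2-2/p}}{p-1}\|Q\|_{p,2}^{2-p}\|Q_i\|_2^{p-2}Q_i,\qquad \bigl(\nabla f_{p,2}^*(Z)\bigr)_i=\frac{p-1}{d_{\mathrm{grp}}^{2-2/p}}\|Z\|_{q,2}^{2-q}\|Z_i\|_2^{q-2}Z_i,$$ where a block is interpreted as $0$ when $Q_i=0$ (resp. $Z_i=0$). Convention: if the denominator in the step size is zero (in which case $J_t(\widehat\Theta_t)=0$ too), set $\eta_{t+1}=0$. *)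

(* Defs.v *)
From mathcomp Require Import all_boot all_order all_algebra.
From mathcomp Require Import all_classical all_reals all_analysis.
From mathcomp Require Import complex ring.

Set Implicit Arguments.
Unset Strict Implicit.
Unset Printing Implicit Defensive.

Import Order.TTheory GRing.Theory Num.Theory.
Import numFieldNormedType.Exports.

Local Open Scope ring_scope.

Section Matrices.
Context {R : realType}.

Definition frob_inner {m n : nat} (X Y : 'M[R]_(m, n)) : R := \tr (X^T *m Y).

Definition frob_norm {m n : nat} (X : 'M[R]_(m, n)) : R :=
  Num.sqrt (frob_inner X X).

(* [lin_mx F] is the real matrix of [F]; its eigenvalues are taken over R[i],
   and [normc] is the modulus with values in [R]. The set below is finite, and
   nonempty for m, n > 0, so that its supremum is a maximum. *)
Definition spectral_radius {m n : nat} (F : 'M[R]_(m, n) -> 'M[R]_(m, n)) : R :=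
  sup [set Normc.normc z | z in
        [set z : R[i] | eigenvalue (map_mx (real_complex R) (lin_mx F)) z]]%classic.

Definition schur_stable {m n : nat} (F : 'M[R]_(m, n) -> 'M[R]_(m, n)) : Prop :=
  spectral_radius F < 1.

(* The gradient with respect to [frob_inner]: the matrix of partial
   derivatives, [delta_mx i j] being an orthonormal basis. *)
Definition grad {m n : nat} (f : 'M[R]_(m, n) -> R) (Q : 'M[R]_(m, n)) :
    'M[R]_(m, n) :=
  \matrix_(i, j) 'D_(delta_mx i j) f Q.

(* Real-valued: only meaningful for those [f] (such as [mirror_map] below) for
   which the supremum is finite at every [Z]. *)
Definition fenchel_conj {m n : nat} (f : 'M[R]_(m, n) -> R)
    (Z : 'M[R]_(m, n)) : R :=
  sup [set frob_inner Z Q - f Q | Q in setT]%classic.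

End Matrices.

(* The groups are the members of a partition [P] of the entry positions. *)
Section Groups.
Context {R : realType} {m k : nat}.
Implicit Types (P : {set {set 'I_m * 'I_k}}) (C : {set 'I_m * 'I_k}).
Implicit Types Q : 'M[R]_(m, k).

Definition group_norm C Q : R := Num.sqrt (\sum_(x in C) Q x.1 x.2 ^+ 2).

Definition mixed_norm P (r : R) Q : R :=
  (\sum_(C in P) group_norm C Q `^ r) `^ r^-1.

Definition mixed_norm_oo P Q : R := \big[Num.max/0]_(C in P) group_norm C Q.

Definition group_sparse P (s : nat) Q : Prop :=
  (#|[pred C in P | [exists x in C, (Q x.1 x.2 != 0)%R]]| <= s)%N.

Definition mirror_map P (p : R) Q : R :=
  #|P|%:R `^ (2 - 2 / p) / (2 * (p - 1)) * mixed_norm P p Q ^+ 2.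

End Groups.

Section Loss.
Context {R : realType} {n1 n2 m k : nat}.
Implicit Types (B : 'M[R]_(m, n2) -> 'M[R]_(n1, n2)) (Theta Q : 'M[R]_(m, k)).
Implicit Types Psi : 'M[R]_(k, n2).

(* [Psi] is here the value of the regressor at the current state and time. *)
Definition loss B Theta Psi Q : R :=
  2^-1 * frob_norm (B ((Theta - Q) *m Psi)) ^+ 2.

Definition step_size (J eps G : R) : R :=
  if eps + G ^+ 2 == 0 then 0 else 2 * J / (eps + G ^+ 2).

Lemma frob_norm_sqr (a b : nat) (X : 'M[R]_(a, b)) :
  frob_norm X ^+ 2 = frob_inner X X.
Proof.
rewrite sqr_sqrtr // /frob_inner /mxtrace sumr_ge0 // => i _.
by rewrite mxE sumr_ge0 // => j _; rewrite mxE -expr2 sqr_ge0.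
Qed.

Lemma grad_lossE (B : {linear 'M[R]_(m, n2) -> 'M[R]_(n1, n2)})
    (BT : 'M[R]_(n1, n2) -> 'M[R]_(m, n2)) Theta Psi Q :
  (forall U V, frob_inner (B U) V = frob_inner U (BT V)) ->
  grad (loss B Theta Psi) Q = - BT (B ((Theta - Q) *m Psi)) *m Psi^T.
Proof.
move=> adjB; apply/matrixP => i j; rewrite mxE /derive.
set E : 'M[R]_(m, k) := delta_mx i j.
set M := B ((Theta - Q) *m Psi); set N := B (E *m Psi).
have innerC (a b : nat) (X Y : 'M[R]_(a, b)) : frob_inner X Y = frob_inner Y X.
  by rewrite /frob_inner -mxtrace_tr trmx_mul trmxK.
have lossE (h : R) : loss B Theta Psi (h *: E + Q) =
    loss B Theta Psi Q - h * frob_inner N M + h ^+ 2 / 2 * frob_inner N N.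
  have -> : loss B Theta Psi (h *: E + Q) = 2^-1 * frob_inner (M - h *: N) (M - h *: N).
    rewrite /loss frob_norm_sqr; suff -> : B ((Theta - (h *: E + Q)) *m Psi) = M - h *: N by [].
    by rewrite opprD addrCA addrC mulmxBl -scalemxAl linearB linearZ.
  rewrite /loss frob_norm_sqr -/M /frob_inner.
  have -> : (M - h *: N)^T = M^T - h *: N^T by apply/matrixP => a b; rewrite !mxE.
  rewrite mulmxBl !mulmxBr -!scalemxAl -!scalemxAr !mxtraceD !raddfN /=.
  rewrite !mxtraceD !raddfN /= !mxtraceZ.
  have -> : \tr (M^T *m N) = \tr (N^T *m M) by exact: innerC.
  by field.
have -> : (- BT M *m Psi^T) i j = - frob_inner N M.
  rewrite adjB /frob_inner trmx_mul mxtrace_mulC mulmxA mxtrace_mulC.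
  rewrite trmx_delta mulNmx mxE -/M; set Y := BT M *m Psi^T; congr (- _).
  rewrite /mxtrace (bigD1 j) //= [X in _ + X]big1 ?addr0.
    rewrite [RHS]mxE (bigD1 i) //= big1 ?addr0 => [|r /negPf ri].
      by rewrite [delta_mx _ _ _ _]mxE !eqxx mul1r.
    by rewrite mxE ri andbF mul0r.
  by move=> l /negPf lj; rewrite mxE big1 // => r _; rewrite mxE lj mul0r.
apply/cvg_lim => //.
suff cvgR : (- frob_inner N M + h / 2 * frob_inner N N @[h --> (0 : R)^'] -->
    - frob_inner N M)%classic.
  apply: cvg_trans cvgR; apply: near_eq_cvg; near=> h.
  have h0 : h != 0 by near: h; exact: nbhs_dnbhs_neq.
  rewrite /= lossE /GRing.scale /=; field.
  exact: h0.
apply: cvg_within_filter.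
suff : (- frob_inner N M + h / 2 * frob_inner N N @[h --> (0 : R)] -->
    - frob_inner N M + 0 / 2 * frob_inner N N)%classic by rewrite !mul0r addr0.
by apply: cvgD; [exact: cvg_cst|apply: cvgMl; apply: cvgMl; exact: cvg_id].
Unshelve. all: by end_near.
Qed.

End Loss.

(* Main.v *)
Require Import Defs.
From HB Require Import structures.
From mathcomp Require Import all_boot all_order all_algebra.
From mathcomp Require Import all_classical all_reals all_analysis.
From mathcomp Require Import complex ring lra.

Set Implicit Arguments.
Unset Strict Implicit.
Unset Printing Implicit Defensive.

Import Order.TTheory GRing.Theory Num.Theory.
Import numFieldNormedType.Exports.

Local Open Scope ring_scope.

(** The algorithm is mirror descent seen from the dual side.  Write [f] for the
    mirror map and [h] for its Fenchel conjugate.  Both are explicit multiples of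
    squared mixed norms, of conjugate exponents p and q, and the two gradient
    maps are inverse to each other.  Hence the iterates are
    [Theta_hat t = grad h (W t)], where the dual variable [W] starts at 0 and moves
    by plain gradient steps [W t.+1 = W t - eta t.+1 *: grad (J t) (Theta_hat t)].

    The Lyapunov function is the Fenchel gap
    [V t = f Theta + h (W t) - <W t, Theta>], nonnegative by the Fenchel-Young
    inequality; it is the Bregman divergence from [Theta] to [Theta_hat t].  The
    function [h] is 1-smooth for the norm of index (oo, 2)
    ([dual_map_smooth_oo]).  Moreover the loss is half the square of a residual that
    is affine in the parameter and vanishes at [Theta], so that
    [<grad J, Theta_hat t - Theta> = 2 J] ([frob_inner_grad_loss]).  One
    step therefore increases [V] by at most [- 2 eta J + eta^2 |grad J|^2 / 2], and
    the Polyak step size turns this into a decrease by at least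
    [2 J^2 / (eps + |grad J|^2)] ([polyak_decrease]).

    Summing, telescoping and applying the Cauchy-Schwarz inequality gives
    [Reg(T)^2 <= (f Theta / 2) * \sum_t (eps + |grad J|^2)]
    ([polyak_regret_sqr]).  Sparsity and the choice of p bound [f Theta]
    ([mirror_map_sparse_le]): d^(1/(1 + ln d)) <= e absorbs the dimensional factor,
    and ln d = 1/(p - 1) is what remains.

    The analytic core is the smoothness of the squared l_q norm for q > 2
    ([lnorm_smooth]).  The gradients in the statement are defined through
    directional derivatives, and the conjugate through a supremum.  The derivatives
    of [h] follow from two-sided bounds ([is_derive_remainder]); for [f] it is
    enough to know that it is differentiable and to exhibit one subgradient
    ([derive_subgradient]). *)

(** * Finite l_r norms and the inequalities of Cauchy-Schwarz and Hoelder *)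

(** The l_r norm of the nonnegative family [x] over [P].  It is locked because
    unification between powers with different exponents would unfold [powR] down
    to the construction of the exponential. *)
HB.lock Definition lnorm (R : realType) (I : finType) (P : {pred I}) (r : R)
  (x : I -> R) : R := (\sum_(i in P) x i `^ r) `^ r^-1.

Section PowerSums.
Context {R : realType} {I : finType} (P : {pred I}).
Implicit Types (x y : I -> R) (p q r : R).

Local Notation lnorm := (lnorm P).

Lemma lnormE r x : lnorm r x = (\sum_(i in P) x i `^ r) `^ r^-1.
Proof. by rewrite unlock. Qed.

Lemma lnorm_ge0 r x : 0 <= lnorm r x.
Proof. by rewrite lnormE powR_ge0. Qed.

Lemma sum_powR_ge0 r x : 0 <= \sum_(i in P) x i `^ r.
Proof. by apply: sumr_ge0 => i _; exact: powR_ge0. Qed.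

Lemma powR_lnorm r x : r != 0 -> lnorm r x `^ r = \sum_(i in P) x i `^ r.
Proof. by move=> r0; rewrite lnormE -powRrM mulVf// powRr1 ?sum_powR_ge0. Qed.

Lemma lnorm_eq0 r x : 0 < r -> (forall i, i \in P -> 0 <= x i) ->
  lnorm r x = 0 -> forall i, i \in P -> x i = 0.
Proof.
rewrite lnormE => r0 x0 /powR_eq0_eq0/eqP.
rewrite psumr_eq0 => [/allP xr0 i iP|i _]; last exact: powR_ge0.
have := xr0 i (mem_index_enum _); rewrite iP /= => /eqP.
exact: powR_eq0_eq0.
Qed.

(** After normalizing both families, sum Young's inequality
    [u * v <= u^p / p + v^q / q]. *)
Lemma finite_hoelder p q x y : 0 < p -> 0 < q -> p^-1 + q^-1 = 1 ->
  (forall i, i \in P -> 0 <= x i) -> (forall i, i \in P -> 0 <= y i) ->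
  \sum_(i in P) x i * y i <= lnorm p x * lnorm q y.
Proof.
move=> p0 q0 pq x0 y0.
have nx0 : 0 <= lnorm p x by exact: lnorm_ge0.
have ny0 : 0 <= lnorm q y by exact: lnorm_ge0.
have [nx|nx] := eqVneq (lnorm p x) 0.
  rewrite nx mul0r big1// => i iP.
  by rewrite (lnorm_eq0 p0 x0 nx iP) mul0r.
have [ny|ny] := eqVneq (lnorm q y) 0.
  rewrite ny mulr0 big1// => i iP.
  by rewrite (lnorm_eq0 q0 y0 ny iP) mulr0.
have {}nx : 0 < lnorm p x by rewrite lt0r nx nx0.
have {}ny : 0 < lnorm q y by rewrite lt0r ny ny0.
have normalized r z : 0 < r -> (forall i, i \in P -> 0 <= z i) -> 0 < lnorm r z ->
    \sum_(i in P) (z i / lnorm r z) `^ r = 1.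
  move=> r0 z0 nz.
  under eq_bigr => i iP do rewrite powRM ?z0 ?invr_ge0 ?ltW//.
  rewrite -mulr_suml -powR_lnorm ?gt_eqF// -powRM ?invr_ge0 ?ltW//.
  by rewrite divff ?gt_eqF// powR1.
have nxy : 0 < lnorm p x * lnorm q y by exact: mulr_gt0.
suff : (\sum_(i in P) x i * y i) / (lnorm p x * lnorm q y) <= 1.
  by rewrite ler_pdivrMr// mul1r.
have -> : (\sum_(i in P) x i * y i) / (lnorm p x * lnorm q y) =
   \sum_(i in P) (x i / lnorm p x) * (y i / lnorm q y).
  by rewrite mulr_suml; apply: eq_bigr => i _; rewrite invfM mulrACA.
apply: (@le_trans _ _ (\sum_(i in P) ((x i / lnorm p x) `^ p / p +
                                      (y i / lnorm q y) `^ q / q))).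
  apply: ler_sum => i iP; apply: conjugate_powR => //.
  - by rewrite divr_ge0 ?x0.
  - by rewrite divr_ge0 ?y0.
by rewrite big_split/= -!mulr_suml !normalized// !mul1r pq.
Qed.

End PowerSums.

Lemma cauchy_schwarz_sum (R : realType)
    (I : Type) (s : seq I) (Q : pred I) (a b : I -> R) :
  (\sum_(i <- s | Q i) a i * b i) ^+ 2 <=
    (\sum_(i <- s | Q i) a i ^+ 2) * \sum_(i <- s | Q i) b i ^+ 2.
Proof.
set D := \sum_(i <- s | Q i) _; set A := \sum_(i <- s | Q i) _.
set B := \sum_(i <- s | Q i) _.
have quad (u v : R) : 0 <= u ^+ 2 * A - 2 * u * v * D + v ^+ 2 * B.
  rewrite /A /B /D !mulr_sumr -sumrB -big_split/=.
  by apply: sumr_ge0 => i _; have := sqr_ge0 (u * a i - v * b i); lra.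
have B0 : 0 <= B by apply: sumr_ge0 => i _; exact: sqr_ge0.
have [BE|BN0] := eqVneq B 0.
  have [DE|DN0] := eqVneq D 0; first by rewrite DE BE expr0n/= mulr0.
  (* a nonzero D would make the quadratic negative at v = (A + 1) / (2 * D) *)
  have := quad 1 ((A + 1) / (2 * D)).
  rewrite BE mulr0 addr0 expr1n mul1r mulr1.
  have -> : 2 * ((A + 1) / (2 * D)) * D = A + 1 by field.
  by move=> h; exfalso; lra.
have {BN0}B0 : 0 < B by rewrite lt0r BN0.
have := quad B D.
have -> : B ^+ 2 * A - 2 * B * D * D + D ^+ 2 * B = B * (A * B - D ^+ 2) by ring.
by rewrite pmulr_rge0// subr_ge0.
Qed.

(** * One-variable calculus *)

Section Calculus.
Context {R : realType}.

Lemma is_derive_bigsum (I : finType) (P : {pred I}) (f : I -> R -> R)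
    (df : I -> R) (x : R) :
  (forall i, i \in P -> is_derive x 1 (f i) (df i)) ->
  is_derive x 1 (fun t => \sum_(i in P) f i t) (\sum_(i in P) df i).
Proof.
move=> fdf; rewrite (_ : (fun t => _) = \sum_(i in P) f i); last first.
  by apply/funext => t; rewrite fct_sumE.
apply: (big_ind2 (fun (g : R -> R) d => is_derive x 1 g d)) => //.
- exact: is_derive_cst.
- by move=> f1 d1 f2 d2 ? ?; exact: is_deriveD.
Qed.

Lemma is_derive_powR (f : R -> R) (df r x : R) : 0 < f x ->
  is_derive x 1 f df ->
  is_derive x 1 (fun t => f t `^ r) (r * f x `^ (r - 1) * df).
Proof.
move=> fx0 fdf; have H := @is_derive1_powR R r (f x) fx0.
have := @is_derive1_comp R (@powR R ^~ r) f x _ _ H fdf.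
exact.
Qed.

Lemma is_derive_mul (f g : R -> R) (df dg x : R) :
  is_derive x 1 f df -> is_derive x 1 g dg ->
  is_derive x 1 (fun t : R => f t * g t) (df * g x + f x * dg).
Proof.
move=> fdf gdg; rewrite (_ : _ + _ = f x *: dg + g x *: df); last first.
  by rewrite /GRing.scale/= addrC [df * _]mulrC.
exact: (is_deriveM fdf gdg).
Qed.

Lemma is_derive_quadratic (a b c x : R) :
  is_derive x 1 (fun t : R => a + b * t + c * t ^+ 2) (b + 2 * c * x).
Proof.
have d0 : is_derive x 1 (cst a : R -> R) 0 by exact: is_derive_cst.
have d1 : is_derive x 1 (id : R -> R) 1 by exact: is_derive_id.
have db : is_derive x 1 (b *: (id : R -> R)) (b *: 1) by exact: is_deriveZ.
have d2 : is_derive x 1 ((id : R -> R) ^+ 2) (2%:R * x ^+ 1 * 1).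
  exact: is_deriveX.
have dc : is_derive x 1 (c *: (id : R -> R) ^+ 2) (c *: (2%:R * x ^+ 1 * 1)).
  exact: is_deriveZ.
rewrite (_ : (fun t => _) = cst a + b *: (id : R -> R) + c *: (id : R -> R) ^+ 2).
  rewrite (_ : b + 2 * c * x = 0 + b *: 1 + c *: (2%:R * x ^+ 1 * 1)).
    exact: (is_deriveD (is_deriveD d0 db) dc).
  by rewrite add0r /GRing.scale/= expr1 !mulr1 mulrA [c * 2]mulrC.
by apply/funext => t; rewrite !fctE.
Qed.

(** Second-order Taylor bound on [0, 1]: the mean value theorem is applied first
    to [f'], then to [f] minus the quadratic majorant of slope [f' 0]. *)
Lemma le_taylor2 (f f' f'' : R -> R) (L : R) :
  (forall x : R, is_derive x 1 f (f' x)) ->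
  (forall x : R, is_derive x 1 f' (f'' x)) ->
  (forall x, f'' x <= L) -> f 1 <= f 0 + f' 0 + L / 2.
Proof.
move=> df df' leL.
have cont (g dg : R -> R) (a b : R) : (forall x : R, is_derive x 1 g (dg x)) ->
    {within `[a, b], continuous g}%classic.
  by move=> dg_; apply: derivable_within_continuous => y _; have := dg_ y; case.
have f'le x : 0 <= x -> f' x <= f' 0 + L * x.
  move=> x0; have [y _] := MVT_segment x0 (fun y _ => df' y) (cont _ _ _ _ df').
  by rewrite subr0 => /eqP; rewrite subr_eq => /eqP ->; rewrite addrC lerD2l ler_wpM2r.
pose h (t : R) := 0 + f' 0 * t + L / 2 * t ^+ 2.
have dg (x : R) : is_derive x 1 (f - h) (f' x - (f' 0 + 2 * (L / 2) * x)).
  by apply: is_deriveB; exact: is_derive_quadratic.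
have [y y01] := MVT_segment ler01 (fun y _ => dg y) (cont _ _ _ _ dg).
rewrite /h !fctE subr0 expr0n expr1n/= !mulr0 !mulr1 !add0r.
rewrite in_itv/= in y01; have /andP[y0 _] := y01.
by have := f'le y y0; lra.
Qed.

End Calculus.

Section Derivatives.
Context {R : realType}.

(** The exponent [r] allows remainders of order strictly between 1 and 2, such as
    [|t|^p]; the conjugate has quadratic remainders, with [r = 1]. *)
Lemma is_derive_remainder (V : normedModType R) (f : V -> R) (x v : V) (l K r : R) :
  0 < r ->
  (forall t : R, `|f (t *: v + x) - f x - t * l| <= K * `|t| * `|t| `^ r) ->
  is_derive x v f l.
Proof.
move=> r0 rem.
suff quot : ((fun t : R => t^-1 *: ((f \o shift x) (t *: v) - f x)) t @[t --> (0 : R)^']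
    --> l)%classic.
  apply: DeriveDef; first by apply/cvg_ex; exists l.
  by apply/cvg_lim.
have Kp : 0 < `|K| + 1 by rewrite ltr_wpDl.
apply/cvgrPdist_lt => e e0.
have dp : 0 < (e / (`|K| + 1)) `^ r^-1 by rewrite powR_gt0// divr_gt0.
near=> t.
have t0 : t != 0 by near: t; exact: nbhs_dnbhs_neq.
have nt0 : 0 < `|t| by rewrite normr_gt0.
have tp : `|t| `^ r < e / (`|K| + 1).
  have tlt : `|t| < (e / (`|K| + 1)) `^ r^-1 by near: t; exact: dnbhs0_lt.
  have := @gt0_ltr_powR _ r r0 `|t| ((e / (`|K| + 1)) `^ r^-1).
  rewrite !nnegrE normr_ge0 powR_ge0 => /(_ isT isT tlt).
  by rewrite -powRrM mulVf ?gt_eqF// powRr1// divr_ge0// ltW.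
rewrite distrC /= /GRing.scale/=.
have -> : t^-1 * (f (t *: v + x) - f x) - l = t^-1 * (f (t *: v + x) - f x - t * l).
  by field.
rewrite normrM normfV mulrC ltr_pdivrMr//.
apply: (le_lt_trans (rem t)); rewrite mulrAC ltr_pM2r//.
apply: (@le_lt_trans _ _ ((`|K| + 1) * `|t| `^ r)).
  by rewrite ler_wpM2r ?powR_ge0// (le_trans (ler_norm _))// lerDl.
by rewrite mulrC -ltr_pdivlMr.
Unshelve. all: by end_near.
Qed.

(** The difference quotients are at least [l] on the right of 0 and at most [l] on
    the left, so their common limit is [l]. *)
Lemma derive_subgradient (V : normedModType R) (f : V -> R) (x v : V) (l : R) :
  derivable f x v -> (forall t : R, f x + t * l <= f (t *: v + x)) ->
  'D_v f x = l.
Proof.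
move=> dfx sub; pose q (t : R) := t^-1 *: ((f \o shift x) (t *: v) - f x).
have qD : (q t @[t --> (0 : R)^'] --> 'D_v f x)%classic by exact: dfx.
apply/eqP; rewrite eq_le; apply/andP; split.
- have qDl : (q t @[t --> (0 : R)^'-] --> 'D_v f x)%classic.
    exact: cvg_dnbhs_at_left.
  apply: (cvgr_to_le qDl); near=> t.
  have t0 : t < 0 by near: t; exact: nbhs_left_lt.
  rewrite /q /GRing.scale/= mulrC ler_ndivrMr// lerBrDl mulrC; exact: sub.
- have qDr : (q t @[t --> (0 : R)^'+] --> 'D_v f x)%classic.
    exact: cvg_dnbhs_at_right.
  apply: (cvgr_to_ge qDr); near=> t.
  have t0 : 0 < t by near: t; exact: nbhs_right_gt.
  rewrite /q /GRing.scale/= mulrC ler_pdivlMr// lerBrDl mulrC; exact: sub.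
Unshelve. all: by end_near.
Qed.

Lemma derivable_line (V : normedModType R) (f : V -> R) (x v : V) :
  derivable (fun t : R => f (t *: v + x)) (0 : R) 1 -> derivable f x v.
Proof.
pose g (t : R) : R := f (t *: v + x); rewrite -/g => dg.
have gE : (fun h : R => h^-1 *: ((g \o shift (0 : R)) (h *: (1 : R)) - g 0)) =
    (fun h : R => h^-1 *: ((f \o shift x) (h *: v) - f x)).
  by apply/funext => h; rewrite /g/= scale0r add0r addr0 /GRing.scale/= mulr1.
by move: dg; rewrite /derivable gE.
Qed.

(** Moving one entry [x] of a matrix by [t] changes its squared l_(r,2) norm into an
    expression of this form: [s] comes from the other entries of the group and [S]
    from the other groups.  The inner power is smooth unless [s] and [x] vanish, in
    which case it is [|t|^r], with derivative 0 at 0 since [1 < r].  The outer power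
    is smooth unless [S] vanishes as well, in which case the two powers compose to
    [|t|^2]. *)
Lemma derivable_powR_sqr (r s x S : R) : 1 < r -> 0 <= s -> 0 <= S ->
  derivable (fun t : R => (S + (s + (x + t) ^+ 2) `^ (r / 2)) `^ (2 / r)) (0 : R) 1.
Proof.
move=> r1 s0 S0.
have r0 : 0 < r by rewrite (lt_trans _ r1).
have outer (u : R -> R) (du : R) : 0 < S + u 0 ->
    is_derive (0 : R) 1 u du ->
    derivable (fun t : R => (S + u t) `^ (2 / r)) (0 : R) 1.
  move=> Su0 udu.
  have d : is_derive (0 : R) 1 (fun t : R => S + u t) (0 + du).
    have := is_deriveD (is_derive_cst S (0 : R) 1) udu.
    exact.
  by have [] := @is_derive_powR _ (fun t : R => S + u t) _ (2 / r) _ Su0 d.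
have [sx|sxN0] := eqVneq (s + x ^+ 2) 0.
  have [s_eq0 x_eq0] : s = 0 /\ x = 0.
    move/eqP: sx; rewrite paddr_eq0 ?sqr_ge0//.
    by rewrite sqrf_eq0 => /andP[/eqP -> /eqP ->].
  have powE (t : R) : (s + (x + t) ^+ 2) `^ (r / 2) = `|t| `^ r.
    rewrite s_eq0 x_eq0 !add0r -(real_normK (num_real t)) -powR_mulrn//.
    by rewrite -powRrM mulrC divfK.
  under eq_fun do rewrite powE.
  move: S0; rewrite le_eqVlt => /predU1P[<-|S0].
    suff d : is_derive (0 : R) 1 (fun t : R => (0 + `|t| `^ r) `^ (2 / r)) 0 by case: d.
    apply: (@is_derive_remainder _ _ _ _ 0 1 1) => // t.
    rewrite !add0r mulr0 subr0 addr0 normr0 powR0 ?gt_eqF//.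
    rewrite powR0 ?gt_eqF ?divr_gt0// subr0 mul1r powRr1//.
    rewrite -powRrM mulrC divfK ?gt_eqF// powR_mulrn// ger0_norm// scaler1.
    by rewrite expr2.
  apply: (outer (fun t : R => `|t| `^ r) 0).
    by rewrite ltr_wpDr ?powR_ge0.
  apply: (@is_derive_remainder _ _ _ _ 0 1 (r - 1)); first by rewrite subr_gt0.
  move=> t; rewrite mulr0 subr0 addr0 normr0 powR0 ?gt_eqF// subr0 mul1r.
  by rewrite scaler1 mulr_powRB1// ger0_norm ?powR_ge0.
have sx0 : 0 < s + x ^+ 2 by rewrite lt0r sxN0 addr_ge0// sqr_ge0.
have q0 : 0 < (fun t : R => s + (x + t) ^+ 2) 0 by rewrite addr0.
have dq : is_derive (0 : R) 1 (fun t : R => s + (x + t) ^+ 2) (2 * x + 2 * 1 * 0).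
  have := is_derive_quadratic (s + x ^+ 2) (2 * x) 1 (0 : R).
  rewrite (_ : (fun t : R => _) = (fun t : R => s + (x + t) ^+ 2)); first exact.
  by apply/funext => t; ring.
apply: (outer (fun t : R => (s + (x + t) ^+ 2) `^ (r / 2)) _ _
  (@is_derive_powR _ (fun t : R => s + (x + t) ^+ 2) _ (r / 2) _ q0 dq)).
rewrite /= addr0; by rewrite ltr_wpDl// powR_gt0.
Qed.

End Derivatives.

(** * Smoothness of the squared l_q norm *)

Section Smoothness.
Context {R : realType} {I : finType} (P : {pred I}).
Implicit Types (a b c x y : I -> R) (p q r : R).

(** Hoelder's inequality with exponents [r / (r - 1)] and [r]; this is the bound
    of the second derivative in the next lemma. *)
Lemma lnorm_hoelder_pow r x y : 1 < r ->
  (forall i, i \in P -> 0 <= x i) -> (forall i, i \in P -> 0 <= y i) ->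
  \sum_(i in P) x i `^ (r - 1) * y i <=
    (\sum_(i in P) x i `^ r) `^ (1 - r^-1) * lnorm P r y.
Proof.
move=> r1 x0 y0.
have r0 : 0 < r by rewrite (lt_trans _ r1).
have r10 : 0 < r - 1 by rewrite subr_gt0.
have rN0 : r != 0 by rewrite gt_eqF.
have r1N0 : r - 1 != 0 by rewrite gt_eqF.
have pE : (r / (r - 1))^-1 = 1 - r^-1 by field; rewrite r1N0 rN0.
have p0 : 0 < r / (r - 1) by exact: divr_gt0.
have pq : (r / (r - 1))^-1 + r^-1 = 1 by rewrite pE subrK.
have xr0 i : i \in P -> 0 <= x i `^ (r - 1) by move=> _; exact: powR_ge0.
apply: le_trans (finite_hoelder p0 r0 pq xr0 y0) _.
rewrite (lnormE P (r / _)) pE.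
rewrite (eq_bigr (fun i => x i `^ r)) => [|i _]; first by rewrite lexx.
by rewrite -powRrM mulrCA divff// mulr1.
Qed.

(** Smoothness of the squared l_q norm of a family of vectors, for [q = 2 * r].
    For vectors [z i] and [y i], take [a i = |z i|^2], [b i = <z i, y i>] and
    [c i = |y i|^2]: then [v i t := a i + 2 * b i * t + c i * t ^+ 2] is
    [|z i + t y i|^2], and [lnorm P r (v^~ t)] is the squared norm along the
    segment.  Its second derivative is at most [2 * (2 * r - 1) * lnorm P r c]: the
    term carrying the factor [r^-1 - 1] is nonpositive, the derivatives [w i] of the
    quadratics satisfy [w i ^+ 2 <= 4 * c i * v i] by the discriminant condition,
    and Hoelder's inequality cancels the remaining power of the norm.  Positivity of
    the quadratics keeps all powers differentiable. *)
Lemma lnorm_smooth_pos r a b c : 1 < r -> (exists i, i \in P) ->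
  (forall i t, i \in P -> 0 < a i + 2 * b i * t + c i * t ^+ 2) ->
  (forall i, i \in P -> 0 <= c i /\ b i ^+ 2 <= a i * c i) ->
  lnorm P r (fun i => a i + 2 * b i + c i) <=
    lnorm P r a + (\sum_(i in P) a i `^ r) `^ (r^-1 - 1) *
      \sum_(i in P) a i `^ (r - 1) * (2 * b i) + (2 * r - 1) * lnorm P r c.
Proof.
move=> r1 [i0 Pi0] v0 bac.
have r0 : 0 < r by rewrite (lt_trans _ r1).
have rN0 : r != 0 by rewrite gt_eqF.
pose v i t := a i + 2 * b i * t + c i * t ^+ 2.
pose w i t := 2 * b i + 2 * c i * t.
have dv i (t : R) : is_derive t 1 (v i) (w i t) by exact: is_derive_quadratic.
have dw i (t : R) : is_derive t 1 (w i) (2 * c i).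
  have := is_derive_quadratic (2 * b i) (2 * c i) 0 t.
  rewrite mulr0 mul0r addr0 (_ : (fun _ => _) = w i)//.
  by apply/funext => u; rewrite mul0r addr0.
pose M t := \sum_(i in P) v i t `^ r.
pose S t := \sum_(i in P) v i t `^ (r - 1) * w i t.
pose D t := \sum_(i in P) ((r - 1) * v i t `^ (r - 1 - 1) * w i t * w i t +
   v i t `^ (r - 1) * (2 * c i)).
have M0 t : 0 < M t.
  rewrite /M (bigD1 i0)//= ltr_pwDl ?powR_gt0 ?v0//.
  by apply: sumr_ge0 => i _; exact: powR_ge0.
have dM (t : R) : is_derive t 1 M (r * S t).
  rewrite mulr_sumr (eq_bigr (fun i => r * v i t `^ (r - 1) * w i t)); last first.
    by move=> i _; rewrite mulrA.
  by apply: is_derive_bigsum => i iP; apply: is_derive_powR => //; exact: v0.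
have dS (t : R) : is_derive t 1 S (D t).
  apply: is_derive_bigsum => i iP; apply: is_derive_mul => //.
  by apply: is_derive_powR => //; exact: v0.
pose f' t := M t `^ (r^-1 - 1) * S t.
pose f'' t := (r^-1 - 1) * M t `^ (r^-1 - 1 - 1) * (r * S t) * S t +
   M t `^ (r^-1 - 1) * D t.
have df (t : R) : is_derive t 1 (fun t : R => M t `^ r^-1) (f' t).
  have := is_derive_powR r^-1 (M0 t) (dM t).
  by rewrite (_ : _ * (r * _) = f' t)// /f'; field.
have df' (t : R) : is_derive t 1 f' (f'' t).
  by apply: is_derive_mul => //; exact: is_derive_powR.
have f''le t : f'' t <= 2 * ((2 * r - 1) * lnorm P r c).
  apply: (@le_trans _ _ (M t `^ (r^-1 - 1) * D t)).
    rewrite gerDr (_ : _ * (r * S t) * S t =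
      - ((r - 1) * M t `^ (r^-1 - 1 - 1) * S t ^+ 2)); last first.
      by field.
    by rewrite oppr_le0 mulr_ge0 ?sqr_ge0// mulr_ge0 ?powR_ge0// subr_ge0 ltW.
  have Dle : D t <= 2 * (2 * r - 1) * \sum_(i in P) v i t `^ (r - 1) * c i.
    rewrite mulr_sumr; apply: ler_sum => i iP.
    have vi0 := v0 i t iP; rewrite -/(v i t) in vi0.
    have -> : v i t `^ (r - 1) = v i t * v i t `^ (r - 1 - 1).
      by rewrite mulr_powRB1 ?subr_gt0// ltW.
    set u := v i t `^ (r - 1 - 1).
    have u0 : 0 <= u by exact: powR_ge0.
    have [ci0 bi] := bac i iP.
    (* c i * v i t - (b i + c i * t) ^ 2 = a i * c i - b i ^ 2 for all t *)
    suff : 0 <= (4 * (r - 1) * u) * (a i * c i - b i ^+ 2).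
      by rewrite /w /v; lra.
    by rewrite !mulr_ge0 ?subr_ge0// ltW.
  apply: le_trans (ler_wpM2l (powR_ge0 _ _) Dle) _.
  rewrite mulrCA -mulrA mulrA [X in _ <= X]mulrA.
  apply: ler_wpM2l; first by lra.
  have vt0 i : i \in P -> 0 <= v i t by move=> iP; exact/ltW/v0.
  have := lnorm_hoelder_pow r1 vt0 (fun i iP => proj1 (bac i iP)).
  move=> /(ler_wpM2l (powR_ge0 (M t) (r^-1 - 1)))/le_trans; apply.
  rewrite mulrA -/(M t) -powRD; last by rewrite (gt_eqF (M0 t)) implybT.
  by rewrite (_ : _ + _ = 0) ?powRr0 ?mul1r//; ring.
have := le_taylor2 df df' f''le.
rewrite (_ : 2 * _ / 2 = (2 * r - 1) * lnorm P r c); last by field.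
rewrite !lnormE /f' /M /S.
have v0E i : v i 0 = a i by rewrite /v expr0n/= !mulr0 !addr0.
have v1E i : v i 1 = a i + 2 * b i + c i by rewrite /v expr1n !mulr1.
have w0E i : w i 0 = 2 * b i by rewrite /w mulr0 addr0.
under eq_bigr do rewrite v1E.
under [in X in _ <= X + _ + _ -> _]eq_bigr do rewrite v0E.
under [in X in _ <= _ + (X `^ _) * _ + _ -> _]eq_bigr do rewrite v0E.
under [in X in _ <= _ + _ * X + _ -> _]eq_bigr do rewrite v0E w0E.
by [].
Qed.

End Smoothness.

Section SmoothnessLimit.
Context {R : realType}.
Implicit Types r : R.

Lemma cvg_powR_gt0 (T : Type) (F : set_system T) (FF : Filter F) (f : T -> R)
    (l r : R) : 0 < l ->
  (f x @[x --> F] --> l -> f x `^ r @[x --> F] --> l `^ r)%classic.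
Proof.
move=> l0; apply: (@continuous_cvg _ _ _ _ FF f (@powR R ^~ r)).
apply/differentiable_continuous/derivable1_diffP/derivable_powR.
by rewrite in_itv/= andbT.
Qed.

Lemma cvg_powR_shift (x r : R) : 0 <= x -> 0 < r ->
  ((x + d) `^ r @[d --> 0^'+] --> x `^ r)%classic.
Proof.
rewrite le_eqVlt => /predU1P[<- r0|x0 _].
  under eq_fun do rewrite add0r.
  by rewrite powR0 ?gt_eqF//; exact: powR_cvg0.
apply: cvg_powR_gt0 => //; apply: cvg_at_right_filter.
rewrite -[X in (_ --> X)%classic]addr0.
by apply: cvgD; [exact: cvg_cst|exact: cvg_id].
Qed.

Lemma cvg_mul (T : Type) (F : set_system T) (FF : Filter F) (f g : T -> R)
    (a b : R) : (f x @[x --> F] --> a)%classic ->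
  (g x @[x --> F] --> b)%classic -> (f x * g x @[x --> F] --> a * b)%classic.
Proof. by move=> fa gb; exact: (cvgM fa gb). Qed.

Lemma cvg_bigsum (T : Type) (F : set_system T) (FF : Filter F)
    (I : finType) (P : {pred I}) (f : I -> T -> R) (l : I -> R) :
  (forall i, i \in P -> (f i x @[x --> F] --> l i)%classic) ->
  (\sum_(i in P) f i x @[x --> F] --> \sum_(i in P) l i)%classic.
Proof.
move=> fl; rewrite (_ : (fun t => _) = \sum_(i in P) f i); last first.
  by apply/funext => t; rewrite fct_sumE.
apply: (big_ind2 (fun (g : T -> R) m => (g x @[x --> F] --> m)%classic)) => //.
- exact: cvg_cst.
- by move=> f1 d1 f2 d2 ? ?; exact: cvgD.
Qed.

Context {I : finType} (P : {pred I}).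
Implicit Types a b c x y : I -> R.

Lemma le_lnorm r x y : 0 < r -> (forall i, i \in P -> 0 <= x i <= y i) ->
  lnorm P r x <= lnorm P r y.
Proof.
move=> r0 xy; rewrite !lnormE; apply: ge0_ler_powR.
- by rewrite invr_ge0 ltW.
- by rewrite nnegrE sum_powR_ge0.
- by rewrite nnegrE sum_powR_ge0.
apply: ler_sum => i /xy/andP[x0 xyi]; apply: ge0_ler_powR => //.
- exact: ltW.
- by rewrite nnegrE (le_trans x0).
Qed.

(** The positivity assumption is removed by adding [d > 0] to every [a i], which
    amounts to giving each vector one more coordinate, constant along the segment,
    and letting [d] tend to 0.  If [a] vanishes on [P], the term with the negative
    power [r^-1 - 1] has no limit, but then [b] vanishes too and the bound is
    trivial. *)
Lemma lnorm_smooth r a b c : 1 < r ->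
  (forall i, i \in P -> [/\ 0 <= a i, 0 <= c i & b i ^+ 2 <= a i * c i]) ->
  lnorm P r (fun i => a i + 2 * b i + c i) <=
    lnorm P r a + (\sum_(i in P) a i `^ r) `^ (r^-1 - 1) *
      \sum_(i in P) a i `^ (r - 1) * (2 * b i) + (2 * r - 1) * lnorm P r c.
Proof.
move=> r1 abc.
have r0 : 0 < r by rewrite (lt_trans _ r1).
have r10 : 0 < r - 1 by rewrite subr_gt0.
have disc i t : i \in P -> 0 <= a i + 2 * b i * t + c i * t ^+ 2.
  move=> /abc[a0 c0 bac].
  have [c_eq0|cN0] := eqVneq (c i) 0.
    have : b i ^+ 2 <= 0 by move: bac; rewrite c_eq0 mulr0.
    rewrite real_exprn_even_le0 ?num_real//= => /eqP ->.
    by rewrite c_eq0 mulr0 !mul0r !addr0.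
  have {cN0 c0}c0 : 0 < c i by rewrite lt0r cN0 c0.
  have h := sqr_ge0 (c i * t + b i).
  by rewrite -(pmulr_rge0 _ c0); lra.
have [suma0|sumaN0] := eqVneq (\sum_(i in P) a i `^ r) 0.
  have a0 i : i \in P -> a i = 0.
    move=> iP; apply: (@lnorm_eq0 _ _ P r a r0) => //.
      by move=> j /abc[].
    by rewrite lnormE suma0 powR0// gt_eqF ?invr_gt0.
  have b0 i : i \in P -> b i = 0.
    move=> iP; have [_ _] := abc i iP; rewrite (a0 i iP) mul0r.
    by rewrite real_exprn_even_le0 ?num_real//= => /eqP.
  rewrite [X in _ <= _ + _ * X + _]big1 => [|i iP]; last by rewrite b0// !mulr0.
  rewrite mulr0 addr0 (@le_trans _ _ (lnorm P r c))//.
    apply: le_lnorm => // i iP.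
    by rewrite a0// b0// mulr0 !add0r lexx andbT; have [] := abc i iP.
  rewrite -[leLHS]add0r lerD ?lnorm_ge0// ler_peMl ?lnorm_ge0//; lra.
have M0 : 0 < \sum_(i in P) a i `^ r by rewrite lt0r sumaN0 sum_powR_ge0.
have [i0 i0P] : exists i, i \in P.
  apply/existsP; apply: contraNT sumaN0; rewrite negb_exists => /forallP PF.
  by rewrite big1// => i iP; have := PF i; rewrite iP.
have cvgM : ((\sum_(i in P) (a i + d) `^ r) @[d --> 0^'+] -->
    \sum_(i in P) a i `^ r)%classic.
  by apply: cvg_bigsum => i /abc[a0 _ _]; exact: cvg_powR_shift.
have cvgR : ((lnorm P r (fun i => a i + d) +
      (\sum_(i in P) (a i + d) `^ r) `^ (r^-1 - 1) *
      (\sum_(i in P) (a i + d) `^ (r - 1) * (2 * b i)) + (2 * r - 1) * lnorm P r c)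
    @[d --> 0^'+] -->
    lnorm P r a + (\sum_(i in P) a i `^ r) `^ (r^-1 - 1) *
      (\sum_(i in P) a i `^ (r - 1) * (2 * b i)) + (2 * r - 1) * lnorm P r c)%classic.
  apply: cvgD; last exact: cvg_cst.
  apply: cvgD.
    under eq_fun do rewrite lnormE.
    by rewrite lnormE; exact: cvg_powR_gt0.
  apply: cvg_mul; first exact: cvg_powR_gt0.
  apply: cvg_bigsum => i /abc[a0 _ _].
  by apply: cvg_mul; [exact: cvg_powR_shift|exact: cvg_cst].
apply: (cvgr_to_ge cvgR).
near=> d.
have d0 : 0 < d by near: d; exact: nbhs_right_gt.
apply: le_trans (@lnorm_smooth_pos _ _ P r (fun i => a i + d) b c r1 _ _ _).
- apply: le_lnorm => // i iP; have := disc i 1 iP; rewrite expr1n !mulr1 => -> /=.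
  by rewrite !lerD2r lerDl ltW.
- by exists i0.
- by move=> i t iP; have := disc i t iP; lra.
- move=> i /abc[a0 c0 bac]; split => //; apply: (le_trans bac).
  by rewrite ler_wpM2r// lerDl ltW.
Unshelve. all: by end_near.
Qed.

End SmoothnessLimit.

(** * Group norms *)

Section FrobeniusInner.
Context {R : realType} {m k : nat}.
Implicit Types X Y Z : 'M[R]_(m, k).

Lemma frob_innerC X Y : frob_inner X Y = frob_inner Y X.
Proof. by rewrite /frob_inner -mxtrace_tr trmx_mul trmxK. Qed.

Lemma frob_innerDl X Y Z : frob_inner (X + Y) Z = frob_inner X Z + frob_inner Y Z.
Proof. by rewrite /frob_inner linearD/= mulmxDl mxtraceD. Qed.

Lemma frob_innerZl (c : R) X Y : frob_inner (c *: X) Y = c * frob_inner X Y.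
Proof. by rewrite /frob_inner linearZ/= -scalemxAl mxtraceZ. Qed.

Lemma frob_innerDr X Y Z : frob_inner X (Y + Z) = frob_inner X Y + frob_inner X Z.
Proof. by rewrite frob_innerC frob_innerDl !(frob_innerC X). Qed.

Lemma frob_innerZr (c : R) X Y : frob_inner X (c *: Y) = c * frob_inner X Y.
Proof. by rewrite frob_innerC frob_innerZl frob_innerC. Qed.

Lemma frob_innerNr X Y : frob_inner X (- Y) = - frob_inner X Y.
Proof. by rewrite -scaleN1r frob_innerZr mulN1r. Qed.

Lemma frob_inner_delta X i j : frob_inner (delta_mx i j) X = X i j.
Proof.
rewrite /frob_inner /mxtrace (bigD1 j)//= [X in _ + X]big1 ?addr0.
  rewrite mxE (bigD1 i)//= big1 ?addr0 => [|r /negPf ri].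
    by rewrite !mxE !eqxx mul1r.
  by rewrite !mxE ri mul0r.
by move=> l /negPf lj; rewrite mxE big1// => r _; rewrite !mxE lj andbF mul0r.
Qed.

End FrobeniusInner.

Section GroupNorms.
Context {R : realType} {m k : nat} (P : {set {set 'I_m * 'I_k}}).
Implicit Types (C : {set 'I_m * 'I_k}) (X Y Z H Q : 'M[R]_(m, k)) (p q r : R).

Definition group_dot C X Y : R := \sum_(x in C) X x.1 x.2 * Y x.1 x.2.

Lemma group_norm_ge0 C X : 0 <= group_norm C X.
Proof. exact: sqrtr_ge0. Qed.

Lemma group_dot_ge0 C X : 0 <= group_dot C X X.
Proof. by apply: sumr_ge0 => x _; rewrite -expr2 sqr_ge0. Qed.

Lemma group_normE C X : group_norm C X = Num.sqrt (group_dot C X X).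
Proof. by congr Num.sqrt; apply: eq_bigr => x _; rewrite expr2. Qed.

Lemma group_norm_sqr C X : group_norm C X ^+ 2 = group_dot C X X.
Proof. by rewrite group_normE sqr_sqrtr ?group_dot_ge0. Qed.

Lemma group_norm_powR C X r : group_norm C X `^ r = group_dot C X X `^ (r / 2).
Proof.
by rewrite group_normE -powR12_sqrt ?group_dot_ge0// -powRrM mulrC.
Qed.

Lemma group_dot_sqr_le C X Y :
  group_dot C X Y ^+ 2 <= group_dot C X X * group_dot C Y Y.
Proof.
rewrite /group_dot; under [in leRHS]eq_bigr do rewrite -expr2.
under [X in _ <= _ * X]eq_bigr do rewrite -expr2.
exact: cauchy_schwarz_sum.
Qed.

Lemma group_dot_le C X Y : group_dot C X Y <= group_norm C X * group_norm C Y.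
Proof.
apply: (le_trans (ler_norm _)).
rewrite -(@ler_pXn2r _ 2)// ?nnegrE ?mulr_ge0 ?group_norm_ge0//.
by rewrite real_normK ?num_real// exprMn !group_norm_sqr group_dot_sqr_le.
Qed.

Lemma group_dotDD C X Y : group_dot C (X + Y) (X + Y) =
  group_dot C X X + 2 * group_dot C X Y + group_dot C Y Y.
Proof.
rewrite /group_dot mulr_sumr -!big_split; apply: eq_bigr => x _ /=.
by rewrite !mxE; ring.
Qed.

Lemma mixed_normE r X : mixed_norm P r X = lnorm (mem P) r (group_norm^~ X).
Proof. by rewrite lnormE. Qed.

Lemma mixed_norm_ge0 r X : 0 <= mixed_norm P r X.
Proof. exact: powR_ge0. Qed.

Lemma mixed_norm_powR r X : r != 0 ->
  mixed_norm P r X `^ r = \sum_(C in P) group_norm C X `^ r.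
Proof. by move=> r0; rewrite mixed_normE powR_lnorm. Qed.

Lemma mixed_norm_sqr r X : r != 0 ->
  mixed_norm P r X ^+ 2 = lnorm (mem P) (r / 2) (fun C => group_dot C X X).
Proof.
move=> r0; rewrite -powR_mulrn ?mixed_norm_ge0// lnormE /mixed_norm -powRrM.
rewrite (eq_bigr (fun C => group_dot C X X `^ (r / 2))) => [|C _].
  by rewrite invfM invrK.
exact: group_norm_powR.
Qed.

Lemma mixed_normZ (r c : R) Q : 0 < r ->
  mixed_norm P r (c *: Q) = `|c| * mixed_norm P r Q.
Proof.
move=> r0; have gnZ C : group_norm C (c *: Q) = `|c| * group_norm C Q.
  rewrite !group_normE -sqrtr_sqr -sqrtrM ?sqr_ge0//; congr Num.sqrt.
  by rewrite /group_dot mulr_sumr; apply: eq_bigr => x _; rewrite !mxE; ring.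
rewrite /mixed_norm.
under eq_bigr do rewrite gnZ powRM ?group_norm_ge0//.
rewrite -mulr_sumr powRM ?powR_ge0//; last first.
  by apply: sumr_ge0 => C _; exact: powR_ge0.
by rewrite -powRrM divff ?gt_eqF// powRr1.
Qed.

Lemma mixed_norm_oo_ge0 X : 0 <= mixed_norm_oo P X.
Proof.
by rewrite /mixed_norm_oo; elim/big_ind: _ => // [x y x0 y0|C _];
  rewrite ?le_max ?x0// group_norm_ge0.
Qed.

Lemma group_norm_le_oo C X : C \in P -> group_norm C X <= mixed_norm_oo P X.
Proof. by move=> CP; rewrite /mixed_norm_oo; exact: le_bigmax_cond. Qed.

(** Only the [n] nonzero groups contribute, each at most the largest group norm. *)
Lemma mixed_norm_le_oo r X (n : nat) : 0 < r ->
  (#|[pred C in P | (group_norm C X != 0)%R]| <= n)%N ->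
  mixed_norm P r X <= n%:R `^ r^-1 * mixed_norm_oo P X.
Proof.
move=> r0 cardn.
have -> : n%:R `^ r^-1 * mixed_norm_oo P X =
    (n%:R * mixed_norm_oo P X `^ r) `^ r^-1.
  by rewrite powRM ?powR_ge0// -powRrM divff ?gt_eqF// powRr1 ?mixed_norm_oo_ge0.
apply: ge0_ler_powR.
- by rewrite invr_ge0 ltW.
- by rewrite nnegrE; apply: sumr_ge0 => C _; exact: powR_ge0.
- by rewrite nnegrE mulr_ge0 ?powR_ge0.
rewrite (bigID (fun C => group_norm C X != 0))/= [X in _ + X]big1 ?addr0; last first.
  by move=> C /andP[_]; rewrite negbK => /eqP ->; rewrite powR0 ?gt_eqF.
apply: (@le_trans _ _ (\sum_(C in [pred C in P | group_norm C X != 0])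
    mixed_norm_oo P X `^ r)).
  rewrite (eq_bigl (mem [pred C in P | group_norm C X != 0]))//.
  apply: ler_sum => C /andP[CP _].
  apply: ge0_ler_powR; rewrite ?nnegrE ?group_norm_ge0 ?mixed_norm_oo_ge0//.
    exact: ltW.
  exact: group_norm_le_oo.
by rewrite sumr_const -[leLHS]mulr_natl ler_wpM2r ?powR_ge0// ler_nat.
Qed.

Lemma group_sparse_card s X : group_sparse P s X ->
  (#|[pred C in P | (group_norm C X != 0)%R]| <= s)%N.
Proof.
apply: leq_trans; apply/subset_leq_card/fintype.subsetP => C /andP[CP nC].
rewrite inE CP/=; apply: contraNT nC; rewrite negb_exists_in => /forall_inP C0.
rewrite /group_norm big1 ?sqrtr0// => x /C0; rewrite negbK => /eqP ->.
by rewrite expr0n.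
Qed.

Lemma pblock_partition (Ppart : finset.partition P [set: 'I_m * 'I_k]%SET) x :
  finset.pblock P x \in P /\ x \in finset.pblock P x.
Proof.
have xcov : x \in finset.cover P.
  by rewrite (finset.cover_partition Ppart) inE.
by rewrite finset.pblock_mem// finset.mem_pblock.
Qed.

Lemma mixed_norm_oo_eq0 X : finset.partition P [set: 'I_m * 'I_k]%SET ->
  mixed_norm_oo P X = 0 -> X = 0.
Proof.
move=> Ppart X0; apply/matrixP => i j; rewrite mxE.
have [CP ijC] := pblock_partition Ppart (i, j).
have : group_norm (finset.pblock P (i, j)) X = 0.
  by apply/eqP; rewrite eq_le group_norm_ge0 andbT -X0 group_norm_le_oo.
move=> /(congr1 (fun x => x ^+ 2)); rewrite group_norm_sqr expr0n/= => /eqP.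
rewrite psumr_eq0 => [/allP/(_ (i, j))|x _]; last by rewrite -expr2 sqr_ge0.
by rewrite mem_index_enum ijC/= mulf_eq0 orbb => /(_ isT)/eqP.
Qed.

Hypothesis Ppart : finset.partition P [set: 'I_m * 'I_k]%SET.

Lemma frob_inner_groups X Y : frob_inner X Y = \sum_(C in P) group_dot C X Y.
Proof.
rewrite -(set_partition_big _ Ppart)/=.
under [RHS]eq_bigl do rewrite inE.
rewrite -(pair_bigA _ (fun i j => X i j * Y i j))/= exchange_big/=.
apply: eq_bigr => j _; rewrite mxE; apply: eq_bigr => i _; by rewrite mxE.
Qed.

Lemma pblock_eq C x : C \in P -> x \in C -> finset.pblock P x = C.
Proof. by apply: finset.def_pblock; exact: finset.partition_trivIset Ppart. Qed.

Lemma frob_hoelder p q X Y : 0 < p -> 0 < q -> p^-1 + q^-1 = 1 ->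
  frob_inner X Y <= mixed_norm P p X * mixed_norm P q Y.
Proof.
move=> p0 q0 pq; rewrite frob_inner_groups !mixed_normE.
apply: (@le_trans _ _ (\sum_(C in P) group_norm C X * group_norm C Y)).
  by apply: ler_sum => C _; exact: group_dot_le.
by apply: finite_hoelder => // C _; exact: group_norm_ge0.
Qed.

(** The gradient of [dual_map] below.  Where a base vanishes, the power [0 `^ (2 - q)]
    or [0 `^ (q - 2)] is [0] for [q != 2], and so is the entry it multiplies. *)
Definition dual_grad (a q : R) Z : 'M[R]_(m, k) :=
  \matrix_(i, j) (a^-1 * mixed_norm P q Z `^ (2 - q) *
                  group_norm (finset.pblock P (i, j)) Z `^ (q - 2) * Z i j).

(** The conjugate of [a / 2 * mixed_norm P p Q ^+ 2] when p and q are conjugate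
    exponents; see [fenchel_conj_mirror_map]. *)
Definition dual_map (a q : R) Z : R := mixed_norm P q Z ^+ 2 / (2 * a).

Lemma frob_dual_grad a q Z H : frob_inner H (dual_grad a q Z) =
  a^-1 * mixed_norm P q Z `^ (2 - q) *
    \sum_(C in P) group_norm C Z `^ (q - 2) * group_dot C Z H.
Proof.
rewrite frob_inner_groups mulr_sumr; apply: eq_bigr => C CP.
rewrite mulrA mulr_sumr; apply: eq_bigr => -[i j] xC /=.
by rewrite mxE (pblock_eq CP xC) mulrC -!mulrA [Z i j * _]mulrC.
Qed.

Lemma frob_dual_gradE a q Z : 2 < q ->
  frob_inner Z (dual_grad a q Z) = a^-1 * mixed_norm P q Z ^+ 2.
Proof.
move=> q2; have q0 : 0 < q by rewrite (lt_trans _ q2).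
rewrite frob_dual_grad -mulrA; congr (_ * _).
rewrite (eq_bigr (fun C => group_norm C Z `^ q)) => [|C _].
  rewrite -mixed_norm_powR ?gt_eqF// -powRD; last first.
    by rewrite subrK pnatr_eq0.
  by rewrite subrK powR_mulrn ?mixed_norm_ge0.
rewrite -group_norm_sqr -powR_mulrn ?group_norm_ge0// -powRD ?subrK//.
by rewrite gt_eqF.
Qed.

Lemma group_norm_dual_grad a q C Z : 0 < a -> 2 < q -> C \in P ->
  group_norm C (dual_grad a q Z) =
  a^-1 * mixed_norm P q Z `^ (2 - q) * group_norm C Z `^ (q - 1).
Proof.
move=> a0 q2 CP.
set c := a^-1 * mixed_norm P q Z `^ (2 - q) * group_norm C Z `^ (q - 2).
have c0 : 0 <= c by rewrite !mulr_ge0 ?powR_ge0// invr_ge0 ltW.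
transitivity (c * group_norm C Z).
  rewrite !group_normE -[in RHS](ger0_norm c0) -sqrtr_sqr -sqrtrM ?sqr_ge0//.
  congr Num.sqrt; rewrite /group_dot mulr_sumr; apply: eq_bigr => -[i j] xC /=.
  by rewrite !mxE (pblock_eq CP xC) -/c; ring.
rewrite /c -!mulrA; congr (_ * (_ * _)); rewrite mulrC.
have -> : q - 2 = q - 1 - 1 by ring.
by rewrite mulr_powRB1 ?group_norm_ge0// subr_gt0 (lt_trans _ q2)// ltr1n.
Qed.

(** [(q - 1) * p = q], so the p-norm of the (q - 1)-th powers of the group norms is
    the (q - 1)-th power of their q-norm. *)
Lemma mixed_norm_dual_grad a p q Z : 0 < a -> 2 < q -> p^-1 + q^-1 = 1 ->
  mixed_norm P p (dual_grad a q Z) = a^-1 * mixed_norm P q Z.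
Proof.
move=> a0 q2 pq; have q0 : 0 < q by rewrite (lt_trans _ q2).
have q1 : 0 < q - 1 by rewrite subr_gt0 (lt_trans _ q2)// ltr1n.
have pE : p = q / (q - 1).
  have : p^-1 = (q - 1) / q by rewrite mulrBl divff ?gt_eqF// mul1r; lra.
  by move=> /(congr1 GRing.inv); rewrite invrK invfM invrK mulrC.
have p0 : 0 < p by rewrite pE divr_gt0.
set c := a^-1 * mixed_norm P q Z `^ (2 - q).
have c0 : 0 <= c by rewrite mulr_ge0 ?powR_ge0// invr_ge0 ltW.
rewrite /mixed_norm.
rewrite (eq_bigr (fun C => c `^ p * group_norm C Z `^ q)) => [|C CP]; last first.
  rewrite group_norm_dual_grad// -/c powRM ?powR_ge0// -powRrM.
  by rewrite pE mulrCA divff ?mulr1// gt_eqF.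
rewrite -mulr_sumr powRM ?powR_ge0//; last first.
  by apply: sumr_ge0 => C _; exact: powR_ge0.
rewrite -powRrM divff ?gt_eqF// powRr1// -mixed_norm_powR ?gt_eqF//.
have -> : p^-1 = 1 - q^-1 by rewrite -pq addrK.
rewrite /c -mulrA; move: (mixed_norm P q Z) (mixed_norm_ge0 q Z) => N N0.
have e1 : 2 - q + (q - 1) = 1 by ring.
rewrite -powRrM mulrBr mulr1 divff ?gt_eqF//.
rewrite -powRD; last by rewrite e1 oner_eq0.
by rewrite e1 -powRrM divff ?gt_eqF// powRr1.
Qed.

(** [lnorm_smooth] with [r = q / 2], applied to the groups of entries. *)
Lemma dual_map_smooth a q Z H : 0 < a -> 2 < q ->
  dual_map a q (Z + H) <= dual_map a q Z + frob_inner H (dual_grad a q Z) +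
    (q - 1) / (2 * a) * mixed_norm P q H ^+ 2.
Proof.
move=> a0 q2; have q0 : 0 < q by rewrite (lt_trans _ q2).
have qN0 : q != 0 by rewrite gt_eqF.
have r1 : 1 < q / 2 by rewrite ltr_pdivlMr// mul1r.
have := @lnorm_smooth R _ (mem P) (q / 2) (fun C => group_dot C Z Z)
  (fun C => group_dot C Z H) (fun C => group_dot C H H) r1.
move=> /(_ (fun C _ => And3 (group_dot_ge0 C Z) (group_dot_ge0 C H)
  (group_dot_sqr_le C Z H))).
rewrite -!mixed_norm_sqr//.
have -> : lnorm (mem P) (q / 2) (fun C => group_dot C Z Z + 2 * group_dot C Z H +
    group_dot C H H) = mixed_norm P q (Z + H) ^+ 2.
  rewrite mixed_norm_sqr// !lnormE; congr (_ `^ _).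
  by apply: eq_bigr => C _; rewrite group_dotDD.
have -> : (\sum_(C in mem P) group_dot C Z Z `^ (q / 2)) `^ ((q / 2)^-1 - 1) =
    mixed_norm P q Z `^ (2 - q).
  rewrite (eq_bigr (fun C => group_norm C Z `^ q)) => [|C _]; last first.
    by rewrite group_norm_powR.
  have e : q * ((q / 2)^-1 - 1) = 2 - q by field.
  by rewrite -(mixed_norm_powR _ qN0) -powRrM e.
have -> : \sum_(C in mem P) group_dot C Z Z `^ (q / 2 - 1) * (2 * group_dot C Z H) =
    2 * \sum_(C in P) group_norm C Z `^ (q - 2) * group_dot C Z H.
  rewrite mulr_sumr; apply: eq_bigr => C _.
  by rewrite group_norm_powR mulrBl divff// mulrCA.
rewrite frob_dual_grad /dual_map.
move: (\sum_(C in P) _) (mixed_norm P q Z `^ (2 - q)) => S N'.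
move: (mixed_norm P q (Z + H)) (mixed_norm P q Z) (mixed_norm P q H) => x y z h.
rewrite ler_pdivrMr ?mulr_gt0//; apply: (le_trans h).
rewrite le_eqVlt; apply/orP; left; apply/eqP; field.
by rewrite gt_eqF.
Qed.

Lemma mirror_map_scale p a Q : a = #|P|%:R `^ (2 - 2 / p) / (p - 1) ->
  mirror_map P p Q = a / 2 * mixed_norm P p Q ^+ 2.
Proof. by move=> ->; rewrite /mirror_map invfM [2^-1 * _]mulrC !mulrA. Qed.

End GroupNorms.

(** * Duality between the mirror map and its conjugate *)

Section MirrorDuality.
Context {R : realType} {m k : nat} (P : {set {set 'I_m * 'I_k}}).
Hypothesis Ppart : finset.partition P [set: 'I_m * 'I_k]%SET.
Variables p q a : R.
Hypotheses (a_gt0 : 0 < a) (p_gt1 : 1 < p) (q_gt2 : 2 < q).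
Hypotheses (pq : p^-1 + q^-1 = 1).
Hypothesis aE : a = #|P|%:R `^ (2 - 2 / p) / (p - 1).
Implicit Types (Z Q H W : 'M[R]_(m, k)).

Local Notation f := (mirror_map P p).
Local Notation h := (dual_map P a q).
Local Notation G := (dual_grad P a q).

Let q_gt0 : 0 < q. Proof. by rewrite (lt_trans _ q_gt2). Qed.
Let p_gt0 : 0 < p. Proof. by rewrite (lt_trans _ p_gt1). Qed.

(** Hoelder's inequality followed by [x * y <= a / 2 * y ^+ 2 + x ^+ 2 / (2 * a)]. *)
Lemma fenchel_young Z Q : frob_inner Z Q <= f Q + h Z.
Proof.
have qp : q^-1 + p^-1 = 1 by rewrite addrC.
apply: (le_trans (frob_hoelder Ppart _ _ q_gt0 p_gt0 qp)).
rewrite (mirror_map_scale _ aE) /dual_map.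
move: (mixed_norm P q Z) (mixed_norm P p Q) => x y.
rewrite -subr_ge0.
have -> : a / 2 * y ^+ 2 + x ^+ 2 / (2 * a) - x * y = (a * y - x) ^+ 2 / (2 * a).
  by field; rewrite gt_eqF.
by rewrite divr_ge0 ?sqr_ge0// mulr_ge0// ltW.
Qed.

Lemma mirror_map_dual_grad Z : f (G Z) = h Z.
Proof.
rewrite (mirror_map_scale _ aE) mixed_norm_dual_grad// /dual_map.
by move: (mixed_norm P q Z) => x; field; rewrite gt_eqF.
Qed.

Lemma fenchel_young_eq Z : frob_inner Z (G Z) = f (G Z) + h Z.
Proof.
rewrite mirror_map_dual_grad frob_dual_gradE// /dual_map.
by move: (mixed_norm P q Z) => x; field; rewrite gt_eqF.
Qed.

(** The supremum is attained at [G Z], where the Fenchel-Young inequality is an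
    equality. *)
Lemma fenchel_conj_mirror_map : fenchel_conj f = h.
Proof.
apply/funext => Z; rewrite /fenchel_conj; apply/eqP; rewrite eq_le.
have ub : ubound [set frob_inner Z Q - f Q | Q in setT]%classic (h Z).
  by move=> _ [Q _ <-]; rewrite lerBlDl fenchel_young.
have hin : [set frob_inner Z Q - f Q | Q in setT]%classic (h Z).
  by exists (G Z) => //; rewrite fenchel_young_eq addrAC subrr add0r.
apply/andP; split; first by apply: ge_sup => //; exists (h Z).
by apply: ub_le_sup => //; exists (h Z).
Qed.

Lemma dual_map_subgradient Z H : h Z + frob_inner H (G Z) <= h (Z + H).
Proof.
have := fenchel_young (Z + H) (G Z).
by rewrite frob_innerDl fenchel_young_eq -addrA lerD2l.
Qed.

(** [h] lies between its tangent, by the Fenchel-Young inequality at [G Z], and the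
    tangent plus a quadratic, by smoothness. *)
Lemma grad_dual_map Z : grad h Z = G Z.
Proof.
apply/matrixP => i j; rewrite mxE.
suff : is_derive Z (delta_mx i j : 'M[R]_(m, k)) h (G Z i j) by case.
apply: (@is_derive_remainder _ _ _ _ _ _
  ((q - 1) / (2 * a) * mixed_norm P q (delta_mx i j) ^+ 2) 1) => // t.
rewrite powRr1// -mulrA -expr2 real_normK ?num_real// [_ + Z]addrC.
have := dual_map_subgradient Z (t *: delta_mx i j).
have := dual_map_smooth Ppart Z (t *: delta_mx i j) a_gt0 q_gt2.
rewrite frob_innerZl frob_inner_delta mixed_normZ// exprMn real_normK ?num_real//.
move: (h (Z + _)) (h Z) (t * _) => x y z ub lb.
rewrite -addrA -opprD ger0_norm; last by rewrite subr_ge0.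
by rewrite lerBlDl -mulrA [_ * t ^+ 2]mulrC.
Qed.

Lemma derivable_mirror_map Q i j : derivable f Q (delta_mx i j).
Proof.
apply: derivable_line.
pose C0 := finset.pblock P (i, j).
have [CP ijC] : C0 \in P /\ (i, j) \in C0 by exact: pblock_partition.
pose S := \sum_(C in P | C != C0) group_norm C Q `^ p.
pose s := \sum_(x in C0 | x != (i, j)) Q x.1 x.2 * Q x.1 x.2.
have entry (t : R) x : (t *: delta_mx i j + Q) x.1 x.2 =
    if x == (i, j) then Q i j + t else Q x.1 x.2.
  case: x => x1 x2 /=; rewrite !mxE xpair_eqE.
  have [->|] /= := eqVneq x1 i; last by rewrite mulr0 add0r.
  have [->|] /= := eqVneq x2 j; last by rewrite mulr0 add0r.
  by rewrite mulr1 addrC.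
have fE (t : R) : f (t *: delta_mx i j + Q) =
    a / 2 * (S + (s + (Q i j + t) ^+ 2) `^ (p / 2)) `^ (2 / p).
  rewrite (mirror_map_scale _ aE); congr (_ * _).
  rewrite -powR_mulrn ?mixed_norm_ge0// /mixed_norm -powRrM mulrC [2 / p]mulrC mulrC.
  rewrite (bigD1 C0)//= addrC group_norm_powR.
  have -> : group_dot C0 (t *: delta_mx i j + Q) (t *: delta_mx i j + Q) =
      s + (Q i j + t) ^+ 2.
    rewrite /group_dot (bigD1 (i, j))//= addrC (entry t (i, j)) eqxx -expr2.
    congr (_ + _); apply: eq_bigr => x /andP[_ /negPf xij].
    by rewrite entry xij.
  rewrite (eq_bigr (fun C => group_norm C Q `^ p))// => C /andP[CinP CN].
  rewrite !group_norm_powR (_ : group_dot C _ _ = group_dot C Q Q)//.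
  apply: eq_bigr => x xC; rewrite entry ifN//; apply: contraNneq CN => xE.
  by rewrite /C0 -xE (pblock_eq Ppart CinP xC).
under eq_fun do rewrite fE.
apply: derivableM; first exact: derivable_cst.
apply: derivable_powR_sqr => //.
- by apply: sumr_ge0 => x _; rewrite -expr2 sqr_ge0.
- by apply: sumr_ge0 => C _; exact: powR_ge0.
Qed.

(** Equality in the Fenchel-Young inequality makes [W] a subgradient of [f] at
    [G W].  Since every iterate is such a point, this identifies the dual variable of
    each iterate. *)
Lemma grad_mirror_map W : grad f (G W) = W.
Proof.
apply/matrixP => i j; rewrite mxE.
apply: derive_subgradient => [|t]; first exact: derivable_mirror_map.
have := fenchel_young W (t *: delta_mx i j + G W).
rewrite frob_innerDr fenchel_young_eq frob_innerZr.
rewrite [frob_inner W (delta_mx _ _)]frob_innerC.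
by rewrite frob_inner_delta addrA lerD2r [t * _ + _]addrC.
Qed.

End MirrorDuality.

Section Descent.
Context {R : realType} {m k : nat} (P : {set {set 'I_m * 'I_k}}).
Hypothesis Ppart : finset.partition P [set: 'I_m * 'I_k]%SET.
Variables p q a : R.
Hypotheses (a_gt0 : 0 < a) (p_gt1 : 1 < p) (q_gt2 : 2 < q).
Hypotheses (pq : p^-1 + q^-1 = 1).
Hypothesis aE : a = #|P|%:R `^ (2 - 2 / p) / (p - 1).

(** The exponents and the scale [a] of the mirror map are tuned to one another:
    passing from the q-norm to the maximum costs [#|P| `^ (2 / q) = a * (p - 1)], and
    [(p - 1) * (q - 1) = 1], so that the smoothness constant is exactly 1. *)
Lemma dual_map_smooth_oo (Z g : 'M[R]_(m, k)) (e : R) :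
  dual_map P a q (Z - e *: g) <= dual_map P a q Z -
    e * frob_inner g (dual_grad P a q Z) + e ^+ 2 / 2 * mixed_norm_oo P g ^+ 2.
Proof.
have q_gt0 : 0 < q by rewrite (lt_trans _ q_gt2).
have p_gt0 : 0 < p by rewrite (lt_trans _ p_gt1).
have := dual_map_smooth Ppart Z (- (e *: g)) a_gt0 q_gt2.
move=> /le_trans; apply; rewrite -scaleNr frob_innerZl mulNr lerD2l.
rewrite mixed_normZ// normrN exprMn real_normK ?num_real//.
have Nq : mixed_norm P q g <= #|P|%:R `^ q^-1 * mixed_norm_oo P g.
  by apply: mixed_norm_le_oo => //; apply/subset_leq_card/fintype.subsetP => C /andP[].
have Nq2 : mixed_norm P q g ^+ 2 <= (#|P|%:R `^ q^-1 * mixed_norm_oo P g) ^+ 2.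
  by rewrite ler_pXn2r// ?nnegrE ?mixed_norm_ge0// mulr_ge0 ?powR_ge0 ?mixed_norm_oo_ge0.
have dq : (#|P|%:R `^ q^-1) ^+ 2 = a * (p - 1).
  rewrite aE divfK ?gt_eqF ?subr_gt0// -powR_mulrn ?powR_ge0// -powRrM.
  have -> : q^-1 = 1 - p^-1 by rewrite -pq addrAC subrr add0r.
  by have -> : (1 - p^-1) * 2 = 2 - 2 / p by ring.
have pq1 : (p - 1) * (q - 1) = 1.
  have : p * q * (p^-1 + q^-1) = p * q by rewrite pq mulr1.
  have -> : p * q * (p^-1 + q^-1) = p + q by field; rewrite !gt_eqF.
  by move=> h; rewrite mulrBl !mulrBr; lra.
rewrite exprMn dq in Nq2.
have K0 : 0 <= (q - 1) / (2 * a).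
  by rewrite divr_ge0 ?mulr_ge0 ?subr_ge0 ?(ltW a_gt0)// ltW// (lt_trans _ q_gt2)// ltr1n.
apply: le_trans (ler_wpM2l K0 (ler_wpM2l (sqr_ge0 e) Nq2)) _.
move: (mixed_norm_oo P g) => x.
rewrite [leLHS](_ : _ = ((p - 1) * (q - 1)) * (e ^+ 2 / 2 * x ^+ 2)); last first.
  by field; rewrite gt_eqF.
by rewrite pq1 mul1r.
Qed.

End Descent.

(** * The gradient of the loss *)

Section LossGradient.
Context {R : realType}.

Lemma frob_inner_suml (I : Type) (r : seq I) (Q : pred I) m n
    (F : I -> 'M[R]_(m, n)) (Y : 'M[R]_(m, n)) :
  frob_inner (\sum_(i <- r | Q i) F i) Y = \sum_(i <- r | Q i) frob_inner (F i) Y.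
Proof.
apply: (big_morph (frob_inner ^~ Y)) => [X Z|]; first exact: frob_innerDl.
by rewrite /frob_inner trmx0 mul0mx mxtrace0.
Qed.

Lemma frob_adjoint m n m' n' (B : {linear 'M[R]_(m, n) -> 'M[R]_(m', n')}) :
  exists BT : 'M[R]_(m', n') -> 'M[R]_(m, n),
    forall U V, frob_inner (B U) V = frob_inner U (BT V).
Proof.
exists (fun V => \matrix_(i, j) frob_inner (B (delta_mx i j)) V) => U V.
set Y := \matrix_(i, j) _.
rewrite (matrix_sum_delta U) linear_sum !frob_inner_suml; apply: eq_bigr => i _.
rewrite linear_sum !frob_inner_suml; apply: eq_bigr => j _.
by rewrite linearZ !frob_innerZl frob_inner_delta mxE.
Qed.

Lemma loss_ge0 n1 n2 m k (B : 'M[R]_(m, n2) -> 'M[R]_(n1, n2))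
    (Theta Q : 'M[R]_(m, k)) (Psi : 'M[R]_(k, n2)) : 0 <= loss B Theta Psi Q.
Proof. by rewrite mulr_ge0 ?sqr_ge0// invr_ge0. Qed.

(** Euler's identity: the loss is a quadratic form in [Q - Theta]. *)
Lemma frob_inner_grad_loss n1 n2 m k
    (B : {linear 'M[R]_(m, n2) -> 'M[R]_(n1, n2)})
    (Theta Q : 'M[R]_(m, k)) (Psi : 'M[R]_(k, n2)) :
  frob_inner (grad (loss B Theta Psi) Q) (Q - Theta) = 2 * loss B Theta Psi Q.
Proof.
have [BT adjB] := frob_adjoint B.
rewrite (grad_lossE _ _ _ adjB) /loss mulVKf ?pnatr_eq0// frob_norm_sqr adjB.
set Y := BT _; rewrite -opprB mulNmx.
rewrite frob_innerNr frob_innerC frob_innerNr opprK /frob_inner.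
by rewrite mulmxA mxtrace_mulC mulmxA trmx_mul.
Qed.

End LossGradient.

(** * Polyak step sizes *)

Section Polyak.
Context {R : realType}.

(** For [w = eps + G^2], the step size [2 * l / w] maximizes over [eta] the
    quadratic [2 * eta * l - eta^2 * w / 2], with maximum [2 * l^2 / w]; and
    [G^2 <= w]. *)
Lemma polyak_decrease (v v' l eps G : R) : 0 <= eps ->
  (eps + G ^+ 2 = 0 -> l = 0) ->
  v' <= v - step_size l eps G * (2 * l) + step_size l eps G ^+ 2 / 2 * G ^+ 2 ->
  l ^+ 2 / (eps + G ^+ 2) <= (v - v') / 2.
Proof.
have halve (x : R) : v' <= v - 4 * x + 2 * x -> x <= (v - v') / 2.
  by move=> ?; lra.
move=> eps0 lw; rewrite /step_size; set w := eps + G ^+ 2.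
have w0 : 0 <= w by rewrite addr_ge0// sqr_ge0.
have Gw : G ^+ 2 <= w by rewrite lerDr.
have [wE|wN0] := eqVneq w 0.
  rewrite lw// !mul0r !expr0n/= !mul0r subr0 addr0 => ?.
  by rewrite divr_ge0// subr_ge0.
set eta := 2 * l / w => vle.
have etaG := ler_wpM2l (divr_ge0 (sqr_ge0 eta) (ler0n R 2)) Gw.
have h1 : eta ^+ 2 / 2 * w = 2 * (l ^+ 2 / w) by rewrite /eta; field.
have h2 : eta * (2 * l) = 4 * (l ^+ 2 / w) by rewrite /eta; field.
rewrite h1 in etaG; rewrite h2 in vle.
exact: halve (le_trans vle (lerD (lexx _) etaG)).
Qed.

Lemma polyak_regret_sqr (V l w : nat -> R) (T : nat) :
  (forall t, 0 <= V t) -> (forall t, 0 <= w t) -> (forall t, w t = 0 -> l t = 0) ->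
  (forall t, l t ^+ 2 / w t <= (V t - V t.+1) / 2) ->
  (\sum_(0 <= t < T) l t) ^+ 2 <= V 0%N / 2 * \sum_(0 <= t < T) w t.
Proof.
move=> V0 w0 lw step.
have sum_step : \sum_(0 <= t < T) l t ^+ 2 / w t <= V 0%N / 2.
  apply: (@le_trans _ _ (\sum_(0 <= t < T) (V t - V t.+1) / 2)).
    by apply: ler_sum => t _; exact: step.
  rewrite -mulr_suml ler_pM2r ?invr_gt0//.
  rewrite (eq_bigr (fun t => - (V t.+1 - V t))) => [|t _]; last exact/esym/opprB.
  by rewrite sumrN telescope_sumr// opprB lerBlDr lerDl.
apply: (@le_trans _ _
  ((\sum_(0 <= t < T) l t ^+ 2 / w t) * \sum_(0 <= t < T) w t)); last first.
  by rewrite ler_wpM2r// sumr_ge0.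
have lE t : l t / Num.sqrt (w t) * Num.sqrt (w t) = l t.
  have [wE|wN0] := eqVneq (w t) 0; first by rewrite lw// mul0r mul0r.
  by rewrite divfK// sqrtr_eq0 -ltNge lt0r wN0 w0.
have lwE t : (l t / Num.sqrt (w t)) ^+ 2 = l t ^+ 2 / w t.
  by rewrite expr_div_n sqr_sqrtr.
have wE t : Num.sqrt (w t) ^+ 2 = w t by rewrite sqr_sqrtr.
rewrite -(eq_bigr _ (fun t _ => lE t)) -(eq_bigr _ (fun t _ => lwE t)).
rewrite -[X in _ <= _ * X](eq_bigr _ (fun t _ => wE t)).
exact: cauchy_schwarz_sum.
Qed.

End Polyak.

(** * The mirror map at a sparse matrix *)

(** From [expR (- 6^-1) >= 5 / 6] one gets [expR 1 <= (6 / 5) ^+ 6 = 2.985...]. *)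
Lemma expR1_lt3 (R : realType) : expR 1 < 3 :> R.
Proof.
have e6 : expR (6^-1 : R) <= 6 / 5.
  have := expR_ge1Dx (- 6^-1 : R); rewrite expRN => h.
  have e0 := expR_gt0 (6^-1 : R).
  by move: h; rewrite -[leRHS]mul1r ler_pdivlMr//; lra.
have -> : expR 1 = expR (6^-1 : R) ^+ 6 by rewrite -expRM_natl divff// pnatr_eq0.
apply: (@le_lt_trans _ _ ((6 / 5) ^+ 6)); last by lra.
by rewrite ler_pXn2r// nnegrE ?expR_ge0// divr_ge0.
Qed.

(** With [L = ln d], the choice [p = 1 + 1 / L] gives [1 / p = L / (1 + L)] and
    [d `^ (2 - 2 / p) = expR (2 * (L / (1 + L))) <= expR 1 ^+ 2]. *)
Lemma mirror_map_sparse_le (R : realType) (m k : nat)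
    (P : {set {set 'I_m * 'I_k}}) (Theta : 'M[R]_(m, k)) (s : nat) (p L : R) :
  (0 < #|P|)%N -> L = ln #|P|%:R -> 0 < L -> p = 1 + 1 / L ->
  group_sparse P s Theta ->
  mirror_map P p Theta / 2 <=
    (expR 1 / 2 * s%:R `^ (L / (1 + L)) * mixed_norm_oo P Theta) ^+ 2 * L.
Proof.
move=> P0 LE L0 pE sparse.
have LN0 : L != 0 by rewrite gt_eqF.
have LS0 : 1 + L != 0 by rewrite gt_eqF// addr_gt0.
have d0 : 0 < #|P|%:R :> R by rewrite ltr0n.
have p1 : 1 < p by rewrite pE ltrDl divr_gt0.
have p0 : 0 < p by rewrite (lt_trans _ p1).
have pV : p^-1 = L / (1 + L).
  have -> : p = (1 + L) / L by rewrite pE; field.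
  by rewrite invf_div.
rewrite (mirror_map_scale _ (erefl _)); set a := _ / (p - 1).
have a0 : 0 < a by rewrite divr_gt0 ?subr_gt0// powR_gt0.
have NT := mixed_norm_le_oo p0 (group_sparse_card sparse).
rewrite pV in NT.
have NT2 : mixed_norm P p Theta ^+ 2 <=
    (s%:R `^ (L / (1 + L)) * mixed_norm_oo P Theta) ^+ 2.
  rewrite ler_pXn2r// ?nnegrE ?mixed_norm_ge0//.
  by rewrite mulr_ge0 ?powR_ge0 ?mixed_norm_oo_ge0.
have ale : a <= expR 1 ^+ 2 * L.
  rewrite /a; have -> : p - 1 = L^-1 by rewrite pE addrAC subrr add0r div1r.
  rewrite invrK ler_pM2r//.
  have -> : 2 - 2 / p = 2 / (1 + L) by rewrite pV; field.
  rewrite /powR gt_eqF// -LE -expRM_natl ler_expR mulr1.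
  by rewrite mulrAC -mulrA ler_piMr// ler_pdivrMr ?addr_gt0// mul1r; lra.
rewrite -[_ * mixed_norm_oo P Theta]mulrA [(_ / 2 * _) ^+ 2]exprMn.
apply: (@le_trans _ _ ((expR 1 ^+ 2 * L) / 2 *
  (s%:R `^ (L / (1 + L)) * mixed_norm_oo P Theta) ^+ 2 / 2)).
  rewrite ler_pM2r ?invr_gt0// ler_pM ?sqr_ge0//.
    by rewrite divr_ge0// ltW.
  by rewrite ler_pM2r ?invr_gt0.
move: (s%:R `^ _ * _) => x.
by rewrite le_eqVlt; apply/orP; left; apply/eqP; field.
Qed.

(** * The regret bound *)

Theorem corollary5 (R : realType) (n1 n2 m k : nat)
  (n1_gt0 : (0 < n1)%N) (n2_gt0 : (0 < n2)%N)
  (m_gt0 : (0 < m)%N) (k_gt0 : (0 < k)%N)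
  (A : {linear 'M[R]_(n1, n2) -> 'M[R]_(n1, n2)})
  (B : {linear 'M[R]_(m, n2) -> 'M[R]_(n1, n2)})
  (K : {linear 'M[R]_(n1, n2) -> 'M[R]_(m, n2)})
  (stable : schur_stable (fun Y : 'M[R]_(n1, n2) => A Y - B (K Y)))
  (Psi : 'M[R]_(n1, n2) -> nat -> 'M[R]_(k, n2))
  (Ud : nat -> 'M[R]_(m, n2))
  (Ud_bounded : exists M : R, forall t : nat, frob_norm (Ud t) <= M)
  (Theta : 'M[R]_(m, k))
  (P : {set {set 'I_m * 'I_k}}) (dgrp : nat)
  (P_partition : finset.partition P [set: 'I_m * 'I_k]%SET)
  (P_card : #|P| = dgrp) (dgrp_ge3 : (3 <= dgrp)%N)
  (p : R) (p_def : p = 1 + 1 / ln (dgrp%:R : R))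
  (s : nat) (s_gt0 : (0 < s)%N) (Theta_sparse : group_sparse P s Theta)
  (X : nat -> 'M[R]_(n1, n2)) (U : nat -> 'M[R]_(m, n2))
  (Theta_hat : nat -> 'M[R]_(m, k)) (J : nat -> 'M[R]_(m, k) -> R)
  (eta eps : nat -> R)
  (X_rec : forall t : nat, X t.+1 = A (X t) + B (Theta *m Psi (X t) t + U t))
  (U_def : forall t : nat, U t = - K (X t) - Theta_hat t *m Psi (X t) t + Ud t)
  (J_def : forall t : nat, J t = loss B Theta (Psi (X t) t))
  (eps_ge0 : forall t : nat, 0 <= eps t.+1)
  (eps_bounded : exists M : R, forall t : nat, eps t.+1 <= M)
  (eta_def : forall t : nat, eta t.+1 =
    step_size (J t (Theta_hat t)) (eps t.+1)
              (mixed_norm_oo P (grad (J t) (Theta_hat t))))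
  (Theta_hat0 : Theta_hat 0%N = 0)
  (Theta_hat_rec : forall t : nat, Theta_hat t.+1 =
    grad (fenchel_conj (mirror_map P p))
      (grad (mirror_map P p) (Theta_hat t)
        - eta t.+1 *: grad (J t) (Theta_hat t)))
  (T : nat) (T_ge1 : (1 <= T)%N) :
  \sum_(0 <= t < T) J t (Theta_hat t) <=
    expR 1 / 2 * s%:R `^ (ln (dgrp%:R : R) / (1 + ln (dgrp%:R : R)))
    * mixed_norm_oo P Theta
    * Num.sqrt (ln (dgrp%:R : R)
        * \sum_(0 <= t < T)
            (eps t.+1 + mixed_norm_oo P (grad (J t) (Theta_hat t)) ^+ 2)).
Proof.
have collect (x1 x2 x3 x4 x5 x6 x7 e : R) :
    x1 <= x2 - e * x3 + e ^+ 2 / 2 * x7 ->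
    x6 + x1 - (x4 - e * x5) <= x6 + x2 - x4 - e * (x3 - x5) + e ^+ 2 / 2 * x7.
  by move=> ?; lra.
set L := ln (dgrp%:R : R).
(* e < 3 <= d: three groups are enough for the conjugate exponent to exceed 2 *)
have L1 : 1 < L.
  rewrite -(expRK (1 : R)) ltr_ln ?posrE ?expR_gt0//; last first.
    by rewrite ltr0n (leq_trans _ dgrp_ge3).
  by rewrite (lt_le_trans (expR1_lt3 R))// ler_nat.
have L0 : 0 < L by rewrite (lt_trans _ L1).
have pE : p = 1 + 1 / L by exact: p_def.
have p1 : 1 < p by rewrite pE ltrDl divr_gt0.
pose q := 1 + L.
have q2 : 2 < q by rewrite /q; lra.
have q0 : 0 < q by rewrite (lt_trans _ q2).
have pq : p^-1 + q^-1 = 1.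
  have -> : p = q / L by rewrite pE /q; field; rewrite gt_eqF.
  by rewrite invf_div -[X in _ + X]mul1r -mulrDl addrC divff// gt_eqF.
have P0 : (0 < #|P|)%N by rewrite P_card (leq_trans _ dgrp_ge3).
pose a := #|P|%:R `^ (2 - 2 / p) / (p - 1).
have aE : a = #|P|%:R `^ (2 - 2 / p) / (p - 1) by [].
have a0 : 0 < a by rewrite divr_gt0 ?subr_gt0// powR_gt0// ltr0n.
pose g t := grad (J t) (Theta_hat t).
(* the dual variable, defined by its gradient steps *)
pose W (t : nat) := - \sum_(0 <= u < t) eta u.+1 *: g u.
have WS t : W t.+1 = W t - eta t.+1 *: g t.
  by rewrite /W big_nat_recr//= opprD.
have W0 : W 0%N = 0 by rewrite /W big_geq// oppr0.
have Theta_hatE t : Theta_hat t = dual_grad P a q (W t).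
  elim: t => [|t IH].
    by rewrite Theta_hat0 W0; apply/matrixP => i j; rewrite !mxE mulr0.
  rewrite Theta_hat_rec -/(g t).
  rewrite (fenchel_conj_mirror_map P_partition a0 p1 q2 pq aE).
  rewrite {1}IH (grad_mirror_map P_partition a0 p1 q2 pq aE) -WS.
  by rewrite (grad_dual_map P_partition a0 p1 q2 pq aE).
pose V t := mirror_map P p Theta + dual_map P a q (W t) - frob_inner (W t) Theta.
have V0 t : 0 <= V t by rewrite subr_ge0; exact: fenchel_young.
pose w t := eps t.+1 + mixed_norm_oo P (g t) ^+ 2.
pose l t := J t (Theta_hat t).
have l0 t : 0 <= l t by rewrite /l J_def loss_ge0.
have w0 t : 0 <= w t by rewrite addr_ge0 ?eps_ge0 ?sqr_ge0.
have inner_g t : frob_inner (g t) (Theta_hat t - Theta) = 2 * l t.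
  by rewrite /g /l J_def frob_inner_grad_loss.
have lw t : w t = 0 -> l t = 0.
  move=> /eqP; rewrite paddr_eq0 ?sqr_ge0 ?eps_ge0// sqrf_eq0 => /andP[_ /eqP g0].
  have := inner_g t; rewrite (mixed_norm_oo_eq0 P_partition g0).
  rewrite /frob_inner trmx0 mul0mx mxtrace0 => /esym/eqP.
  by rewrite mulf_eq0 pnatr_eq0/= => /eqP.
have step t : l t ^+ 2 / w t <= (V t - V t.+1) / 2.
  apply: polyak_decrease; [exact: eps_ge0|exact: lw|].
  rewrite -/(l t) -/(g t) -(eta_def t).
  have h := dual_map_smooth_oo P_partition a0 p1 q2 pq aE (W t) (g t) (eta t.+1).
  rewrite /V WS frob_innerDl -scaleNr frob_innerZl -inner_g frob_innerDr.
  by rewrite scaleNr frob_innerNr Theta_hatE mulNr; exact: collect.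
have V0E : V 0%N = mirror_map P p Theta.
  rewrite /V W0 /dual_map -(scale0r (0 : 'M[R]_(m, k))) mixed_normZ//.
  rewrite normr0 mul0r expr0n mul0r frob_innerZl mul0r subr0; exact: addr0.
have regret := polyak_regret_sqr T V0 w0 lw step.
rewrite V0E in regret.
have LP : L = ln #|P|%:R by rewrite P_card.
have fTheta := mirror_map_sparse_le P0 LP L0 pE Theta_sparse.
set C := expR 1 / 2 * _ * _ in fTheta *.
have C0 : 0 <= C by rewrite !mulr_ge0 ?powR_ge0 ?mixed_norm_oo_ge0 ?expR_ge0.
have sumw0 : 0 <= \sum_(0 <= t < T) w t by exact: sumr_ge0.
have suml0 : 0 <= \sum_(0 <= t < T) l t by apply: sumr_ge0 => t _; exact: l0.
have rhs0 : 0 <= C * Num.sqrt (L * \sum_(0 <= t < T) w t).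
  exact: mulr_ge0 C0 (sqrtr_ge0 _).
rewrite -(@ler_pXn2r _ 2)//.
rewrite exprMn sqr_sqrtr; last by rewrite mulr_ge0// ltW.
by apply: (le_trans regret); rewrite mulrA ler_wpM2r.
Qed.
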